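(* Let $E$ be a topological vector space with the property $(\alpha_4)$ (for example, $E$ is Fréchet--Urysohn). Then $E$ has the property $(K)$ if and only if it has the property $(MK)$.
   Context: A Tychonoff space $X$ has the property $(\alpha_4)$ at a point $x\in X$ if for every family of sequences $\{\xi_n\}_{n\in\omega}$ each converging to $x$, there exists a sequence $\xi$ converging to $x$ such that $\xi_n\cap\xi\neq\emptyset$ for infinitely many $n\in\omega$ (sequences being identified with their sets of terms); $X$ has the property $(\alpha_4)$ if it has it at each point. A Tychonoff space $X$ is Fréchet--Urysohn if for any $A\subseteq X$ and each $x\in\overline{A}$ there is a sequence in $A$ converging to $x$. A null sequence in a topological vector space (tvs) is a sequence converging to $0$. A null sequence $(x_n)_n$ in a tvs $E$ is a $K$-sequence if every subsequence of $(x_n)_n$ contains a subsequence $(y_n)_n$ such that the series $\sum_n y_n$ converges in $E$. A sequence $(x_n)_n$ in $E$ is Mackey null if there exists an increasing unbounded sequence $(a_n)_n$ of positive numbers such that $a_n x_n\to 0$ in $E$. $E$ has the property $(K)$ if every null sequence in $E$ is a $K$-sequence; $E$ has the property $(MK)$ if every Mackey null sequence in $E$ is a $K$-sequence. *)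

(* Defs.v *)
From HB Require Import structures.
From mathcomp Require Import all_boot all_order all_algebra.
From mathcomp Require Export complex.
From mathcomp Require Import all_classical all_reals all_analysis.

Set Implicit Arguments.
Unset Strict Implicit.
Unset Printing Implicit Defensive.

Import Order.TTheory GRing.Theory Num.Theory.
Import numFieldNormedType.Exports.

Local Open Scope classical_set_scope.
Local Open Scope ring_scope.

Definition alpha4_at (X : topologicalType) (x : X) : Prop :=
  forall xi : nat -> nat -> X, (forall n, xi n @ \oo --> x) ->
  exists2 z : nat -> X, z @ \oo --> x &
    infinite_set [set n | range (xi n) `&` range z !=set0].

Definition alpha4 (X : topologicalType) : Prop := forall x : X, alpha4_at x.

Definition frechet_urysohn (X : topologicalType) : Prop :=
  forall (A : set X) (x : X), closure A x ->
  exists2 u : nat -> X, (forall n, A (u n)) & u @ \oo --> x.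

(* The tvs below are [topologicalLmodType]s: the library's [tvsType] is the
   type of locally convex spaces. *)
Section tvs.
Context {K : numFieldType} {E : topologicalLmodType K}.

Definition null_sequence (x : nat -> E) : Prop := x @ \oo --> (0 : E).

Definition K_sequence (x : nat -> E) : Prop :=
  null_sequence x /\
  forall f : nat -> nat, increasing_seq f ->
  exists2 g : nat -> nat, increasing_seq g &
    exists s : E, series (x \o f \o g) @ \oo --> s.

(* The multipliers are scalars so that real and complex spaces are treated
   alike: when [K] is complex, [0 < a n] says that [a n] is a positive real. *)
Definition mackey_null (x : nat -> E) : Prop :=
  exists a : nat -> K,
    [/\ forall n, 0 < a n,
        increasing_seq a,
        forall M : K, M \is Num.real -> exists n, M < a n &
        null_sequence (fun n => a n *: x n)].

End tvs.

Definition property_K (K : numFieldType) (E : topologicalLmodType K) : Prop :=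
  forall x : nat -> E, null_sequence x -> K_sequence x.

Definition property_MK (K : numFieldType) (E : topologicalLmodType K) : Prop :=
  forall x : nat -> E, mackey_null x -> K_sequence x.

(* Main.v *)
Require Import Defs.
From HB Require Import structures.
From mathcomp Require Import all_boot all_order all_algebra.
From mathcomp Require Import complex.
From mathcomp Require Import all_classical all_reals all_analysis.

(** The passage from (MK) to (K) rests on finding a Mackey null subsequence in
every null sequence. Given a null sequence [x], apply alpha4 at 0 to the null
sequences [k |-> (n+1)^2 x_(n+k)]: some null sequence [z] meets infinitely many of
them, say
[(n+1)^2 x_(n + k_n) = z_(m_n)] for [n] in an infinite set. Then
[(n+1) x_(n + k_n) = z_(m_n) / (n+1)] tends to 0, because a null sequence is
bounded, whatever the indices [m_n] are; squaring the multiplier is what makes a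
case distinction on the repetitions of [m_n] superfluous. Thinning out the
infinite set makes [n + k_n] strictly increasing, which gives the Mackey null
subsequence ([null_sequence_mackey_subseq]) to which (MK) applies.
Conversely a Mackey null sequence is null, since [x_n = a_n^-1 (a_n x_n)].

A Hausdorff Frechet-Urysohn space [E] has alpha4 ([frechet_urysohn_alpha4]) by
Nyikos' argument for topological groups: let [xi_n --> x] for each [n], fix a
null sequence of nonzero vectors [a_n] (multiples of one nonzero vector), and
separate [x] from [a_n + x] by disjoint open sets [W_n] and [V_n]. The set [A] of
all [a_n + xi_n(k)] that lie in [V_n] has [x] in its closure, so some sequence
[u_j = a_(n_j) + xi_(n_j)(k_j)] in [A] tends to [x]. Since [u_j] is eventually in
[W_n], which misses [V_n], each [n] equals [n_j] for finitely many [j] only; hence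
[n_j] tends to infinity, and [u_j - a_(n_j)] tends to [x] and meets infinitely
many of the sequences [xi_n].

The real and the complex scalars are treated at once: all that enters is that the
reals among the scalars are archimedean, so that [1/(n+1)] tends to 0. *)

Import Order.TTheory GRing.Theory Num.Theory.
Import numFieldNormedType.Exports.

Local Open Scope classical_set_scope.
Local Open Scope ring_scope.

Lemma increasing_seq_cvgnn (f : nat -> nat) :
  increasing_seq f -> f @ \oo --> \oo.
Proof.
move=> /increasing_seqP fS; apply/cvgnyPge => N; near=> n.
have lef : forall k, (k <= f k)%N.
  by elim=> // k IH; exact: leq_ltn_trans IH (fS k).
by apply: leq_trans (lef n); near: n; exact: nbhs_infty_ge.
Unshelve. all: by end_near. Qed.

Lemma infinite_set_nat_ge (S : set nat) :
  infinite_set S <-> forall N, exists2 n, (N <= n)%N & S n.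
Proof.
split=> [Sinf N|Sge Sfin].
  apply: contrapT => Sub; apply: Sinf.
  apply: sub_finite_set (finite_II N) => n Sn /=.
  by rewrite ltnNge; apply/negP => Nn; apply: Sub; exists n.
have [N SN] : exists N, forall n, S n -> (n < N)%N.
  have [s ->] := (finite_seqP S).1 Sfin.
  exists (\max_(i <- s) i)%N.+1 => n /= ns; rewrite ltnS.
  exact: (leq_bigmax_seq (F := id) n ns isT).
by have [n Nn /SN] := Sge N; rewrite ltnNge Nn.
Qed.

(** The second condition lets the next index outrun any quantity [b] attached to
the current one; it serves to make two index sequences increase together. *)
Lemma infinite_set_extract (S : set nat) (b : nat -> nat) : infinite_set S ->
  exists2 s : nat -> nat, forall i, S (s i) & forall i, (b (s i) < s i.+1)%N.
Proof.
move=> /infinite_set_nat_ge Sge.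
have /choice[h hS] : forall N, exists n, (N <= n)%N /\ S n.
  by move=> N; have [n] := Sge N; exists n.
exists (fun i => iter i (fun n => h (b n).+1) (h 0%N)).
  by case=> [|i]; exact: (hS _).2.
by move=> i; exact: (hS _).1.
Qed.

(** The order of the complex numbers is partial, so the archimedean property can
only be asked of the elements that are real; in this form it covers both fields
of scalars. *)
Definition real_archimedean (K : numDomainType) : Prop :=
  forall M : K, M \is Num.real -> exists n : nat, M < n%:R.

Lemma real_archimedean_archi (R : archiRealDomainType) : real_archimedean R.
Proof.
move=> M _; exists (Num.bound `|M|).
exact: le_lt_trans (ler_norm M) (archi_boundP (normr_ge0 M)).
Qed.

Lemma real_archimedean_complex (R : realType) : real_archimedean R[i]%C.
Proof.
case=> a b; rewrite complex_real => /eqP /= ->.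
have [n an] := @real_archimedean_archi R a (num_real a).
by exists n; rewrite -(rmorph_nat (real_complex R)) ltcR.
Qed.

Section scalars.
Context {K : numFieldType}.
Implicit Types a : nat -> K.

Lemma cvg_inv_unbounded a : (forall n, 0 < a n) -> increasing_seq a ->
  (forall M : K, M \is Num.real -> exists n, M < a n) ->
  (fun n => (a n)^-1) @ \oo --> (0 : K).
Proof.
move=> a0 ainc aub; apply/cvgr0Pnorm_lt => e e0.
have [N aN] : exists N, e^-1 < a N by apply: aub; rewrite gtr0_real ?invr_gt0.
near=> n; rewrite gtr0_norm ?invr_gt0// invf_plt ?posrE//.
apply: lt_le_trans aN _; rewrite ainc.
by near: n; exact: nbhs_infty_ge.
Unshelve. all: by end_near. Qed.

Lemma unbounded_natr (s : nat -> nat) : real_archimedean K ->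
  (forall i, (s i < s i.+1)%N) ->
  [/\ forall i, 0 < (s i).+1%:R :> K,
      increasing_seq (fun i => (s i).+1%:R : K) &
      forall M : K, M \is Num.real -> exists i, M < (s i).+1%:R].
Proof.
move=> Karch sS; split=> [i|i j|M /Karch[n Mn]]; first by rewrite ltr0Sn.
  rewrite ler_nat ltnS -leEnat.
  by have -> : increasing_seq s by apply/increasing_seqP.
exists n; apply: lt_le_trans Mn _; rewrite ler_nat leqW//.
by elim: n {M} => // n IH; exact: leq_ltn_trans IH (sS n).
Qed.

End scalars.

Section tvs.
Context {K : numFieldType} {E : topologicalLmodType K}.
Implicit Types (x z u v : nat -> E) (a c : nat -> K) (w : E).

Lemma tvs_cvgD u v (p q : E) : u @ \oo --> p -> v @ \oo --> q ->
  (fun n => u n + v n) @ \oo --> p + q.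
Proof.
by move=> up vq; apply: (continuous2_cvg (h := +%R) _ _ up vq);
   exact: (@add_continuous E (p, q)).
Qed.

Lemma tvs_cvgB u v (p q : E) : u @ \oo --> p -> v @ \oo --> q ->
  (fun n => u n - v n) @ \oo --> p - q.
Proof.
by move=> up vq; apply: (continuous2_cvg (h := fun s t => s - t) _ _ up vq);
   exact: (@sub_continuous E (p, q)).
Qed.

Lemma tvs_cvgZ c v (p : K) w : c @ \oo --> p -> v @ \oo --> w ->
  (fun n => c n *: v n) @ \oo --> p *: w.
Proof.
move=> cp vw; apply: (continuous2_cvg (V := K^o) (h := *:%R) _ _ cp vw).
exact: (@scale_continuous K E (p, w)).
Qed.

(** This is the boundedness of a null sequence: a tail is absorbed by continuity
of the scaling at [(0, 0)], and each of the finitely many remaining vectors is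
absorbed separately. *)
Lemma null_sequence_bounded c z (m : nat -> nat) :
  c @ \oo --> (0 : K) -> null_sequence z ->
  null_sequence (fun n => c n *: z (m n)).
Proof.
move=> c0 z0 U U0.
have := @scale_continuous K E (0, 0) U.
rewrite /= scale0r => /(_ U0)[[A B] /= [A0 B0] ABU].
have [M _ zB] := z0 B B0.
have cA : \forall n \near \oo, A (c n) by exact: (c0 A A0).
have head : \forall n \near \oo, forall k : 'I_M, U (c n *: z k).
  apply: filter_forall => k.
  have := tvs_cvgZ _ _ _ _ c0 (@cvg_cst E (z k) _ \oo _).
  by rewrite scale0r; apply.
suff cz : \forall n \near \oo, U (c n *: z (m n)) by exact: cz.
near=> n.
have An : A (c n) by near: n.
have hn : forall k : 'I_M, U (c n *: z k) by near: n.
have [kM|Mk] := ltnP (m n) M; first exact: (hn (Ordinal kM)).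
by apply: (ABU (c n, z (m n))); split => //; exact: zB.
Unshelve. all: by end_near. Qed.

Lemma mackey_null_null x : mackey_null x -> null_sequence x.
Proof.
move=> [a [a0 ainc aub ax0]].
have xE : (fun n => (a n)^-1 *: (a n *: x n)) = x.
  by apply/funext => n; rewrite scalerA mulVf ?scale1r// gt_eqF.
have := tvs_cvgZ _ _ _ _ (cvg_inv_unbounded a a0 ainc aub) ax0.
by rewrite scaler0 xE.
Qed.

(** Two powers of [n+1] are put into the sequences fed to alpha4: one becomes the
Mackey multiplier, the other one drives the bounded terms of [z] to 0. *)
Lemma null_sequence_mackey_subseq x : real_archimedean K ->
  alpha4_at (0 : E) -> null_sequence x ->
  exists2 g : nat -> nat, increasing_seq g & mackey_null (x \o g).
Proof.
move=> Karch E4 x0.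
(* The shift by [n] sends the indices of the chosen terms of [x] to infinity. *)
pose xi n k := (n.+1%:R ^+ 2 : K) *: x (n + k)%N.
have xi0 n : xi n @ \oo --> (0 : E).
  rewrite -(scaler0 _ (n.+1%:R ^+ 2 : K)).
  by apply: tvs_cvgZ; [exact: cvg_cst | exact: cvg_comp (cvg_addnl n) x0].
have [z z0 Sinf] := E4 xi xi0.
set S := [set n | _] in Sinf.
have /choice[km kmE] : forall n, exists km : nat * nat,
    S n -> xi n km.1 = z km.2.
  move=> n; have [[_ [[k _ <-] [m _ zm]]]|nS] := pselect (S n).
    by exists (k, m).
  by exists (0%N, 0%N).
pose g n := (n + (km n).1)%N.
have [s sS gs] := infinite_set_extract S g Sinf.
have sinc i : (s i < s i.+1)%N := leq_ltn_trans (leq_addr _ _) (gs i).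
exists (g \o s).
  by apply/increasing_seqP => i; exact: leq_trans (gs i) (leq_addr _ _).
have [a0 ainc aub] := unbounded_natr s Karch sinc.
exists (fun i => (s i).+1%:R); split => //.
have zE : (fun i => (s i).+1%:R *: (x \o (g \o s)) i) =
    (fun i => (s i).+1%:R^-1 *: z (km (s i)).2).
  apply/funext => i.
  by rewrite -kmE// /xi scalerA expr2 mulrA mulVf ?mul1r//.
rewrite zE; apply: (null_sequence_bounded _ _ (fun i => (km (s i)).2)) z0.
exact: cvg_inv_unbounded a0 ainc aub.
Qed.

Lemma property_K_iff_MK : real_archimedean K -> alpha4_at (0 : E) ->
  property_K E <-> property_MK E.
Proof.
move=> Karch E4; split=> [EK x /mackey_null_null/EK//|EMK x x0].
split=> // f /increasing_seq_cvgnn finf.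
have xf0 : null_sequence (x \o f) by exact: cvg_comp finf x0.
have [g ginc xfg] := null_sequence_mackey_subseq _ Karch E4 xf0.
have [_ /(_ id (fun _ _ => erefl))[h hinc [s hs]]] := EMK _ xfg.
exists (g \o h); first by move=> i j /=; rewrite ginc -leEnat hinc.
by exists s.
Qed.

Lemma tvs_nonzero_null_sequence w : real_archimedean K -> w != 0 ->
  exists2 a : nat -> E, null_sequence a & forall n, a n != 0.
Proof.
move=> Karch w0.
have [a0 ainc aub] := unbounded_natr id Karch (fun i => ltnSn i).
exists (fun n => n.+1%:R^-1 *: w).
  rewrite /null_sequence -[X in _ --> X](scale0r w); apply: tvs_cvgZ.
    exact: cvg_inv_unbounded a0 ainc aub.
  exact: cvg_cst.
by move=> n; rewrite scaler_eq0 invr_eq0 pnatr_eq0.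
Qed.

(** Translating [xi n] by a vector [a n <> 0] that tends to 0 with [n] moves its
limit away from [x], so that a sequence tending to [x] can take only finitely many
of its terms near each [a n + x]: this forces it through infinitely many [xi n]. *)
Lemma frechet_urysohn_alpha4 : real_archimedean K -> hausdorff_space E ->
  frechet_urysohn E -> alpha4 E.
Proof.
move=> Karch; rewrite open_hausdorff => EH EFU x xi xix.
(* Without a nonzero vector [E] is a single point and every sequence works. *)
have [[w w0]|E0] := pselect (exists w : E, w != 0); last first.
  have allx (y : E) : y = x.
    have eq0 (v : E) : v = 0.
      by apply: contrapT => /eqP v0; apply: E0; exists v.
    by rewrite (eq0 y) (eq0 x).
  exists (fun=> x); first exact: cvg_cst.
  apply/infinite_set_nat_ge => N; exists N => //.
  by exists x; split; [exists 0%N => // | exists 0%N].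
have [a a_null a0] := tvs_nonzero_null_sequence w Karch w0.
have /choice[VW VWP] : forall n, exists VW : set E * set E,
    [/\ nbhs (a n + x) VW.1, nbhs x VW.2 & VW.1 `&` VW.2 = set0].
  move=> n.
  have /EH[[V W] /= [/set_mem Va /set_mem Wx] [Vo Wo /eqP VW0]] : a n + x != x.
    by rewrite addrC -subr_eq0 addrAC subrr add0r.
  by exists (V, W); split => //; exact: open_nbhs_nbhs.
pose A := [set y | exists n k, y = a n + xi n k /\ (VW n).1 y].
have clA : closure A x.
  move=> B /nbhs_interior Bx.
  have axx : (fun n => a n + x) @ \oo --> x.
    by rewrite -[X in _ --> X]add0r; apply: tvs_cvgD => //; exact: cvg_cst.
  have [n Bn] := @filter_ex _ \oo _ _ (axx _ Bx).
  have [Vn _ _] := VWP n.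
  have axi : (fun k => a n + xi n k) @ \oo --> a n + x.
    by apply: tvs_cvgD => //; exact: cvg_cst.
  have [k [Vk Bk]] := @filter_ex _ \oo _ _ (axi _ (filterI Vn Bn)).
  by exists (a n + xi n k); split => //; exists n, k.
have [u uA ux] := EFU A x clA.
have /choice[nk nkP] : forall j, exists nk : nat * nat,
    u j = a nk.1 + xi nk.1 nk.2 /\ (VW nk.1).1 (u j).
  by move=> j; have [n [k uE]] := uA j; exists (n, k).
have ninf : (fun j => (nk j).1) @ \oo --> \oo.
  apply/cvgnyPge => N.
  have uW : \forall j \near \oo, forall n : 'I_N, (VW n).2 (u j).
    by apply: filter_forall => n; have [_ Wn _] := VWP n; exact: (ux _ Wn).
  near=> j.
  have uWj : forall n : 'I_N, (VW n).2 (u j) by near: j.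
  rewrite leqNgt; apply/negP => nN.
  have [_ _ VW0] := VWP (nk j).1; have [_ Vu] := nkP j.
  have : set0 (u j) by rewrite -VW0; split => //; exact: (uWj (Ordinal nN)).
  by [].
exists (fun j => u j - a (nk j).1).
  rewrite -[X in _ --> X](subr0 x); apply: tvs_cvgB => //.
  exact: cvg_comp ninf a_null.
apply/infinite_set_nat_ge => N.
have /cvgnyPge/(_ N)/filter_ex[j Nj] := ninf.
exists (nk j).1 => //; exists (u j - a (nk j).1); split; last by exists j.
by exists (nk j).2 => //; have [-> _] := nkP j; rewrite addrC addKr.
Unshelve. all: by end_near. Qed.

End tvs.

Theorem proposition2p5 (R : realType) :
  (forall E : topologicalLmodType R, hausdorff_space E ->
     (alpha4 E -> (property_K E <-> property_MK E)) /\
     (frechet_urysohn E -> alpha4 E)) /\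
  (forall E : topologicalLmodType R[i]%C, hausdorff_space E ->
     (alpha4 E -> (property_K E <-> property_MK E)) /\
     (frechet_urysohn E -> alpha4 E)).
Proof.
split=> E EH.
  have arch := @real_archimedean_archi R.
  by split=> [E4|]; [exact: property_K_iff_MK | exact: frechet_urysohn_alpha4].
have arch := real_archimedean_complex R.
by split=> [E4|]; [exact: property_K_iff_MK | exact: frechet_urysohn_alpha4].
Qed.
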